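(* Let $\{(x_k,N_k,\theta_k)\}$ be generated by Algorithm IRETR run with $\varepsilon_g=0$, and suppose it does not terminate in a finite number of steps. Assume that: (1) $h:\mathbb N\to\mathbb R$ is monotone, strictly decreasing, with $h(1)>0$ and $h(N)=0$; (2) $\{x_k\}\subset\Omega$ for some compact set $\Omega\subset\mathbb R^n$; (3) the gradients $\nabla\phi_i$, $1\le i\le N$, are Lipschitz continuous, with a common constant $L$, on the segments $[x_k,x_k+p_k]$ for all $k\ge0$ and all trial steps $p_k$ generated in the repetitions of Steps 2--5; (4) there is $\kappa_B>0$ such that $\|B_{k+1}\|\le\kappa_B$ for all $k$. Then, for $k$ sufficiently large, the iterations are generated by a (standard) trust-region scheme on $f_N$ (that is, $N_k=N_{k+1}=N$, $x_{k+1}=x_k+p_k$ where $p_k$ satisfies the Cauchy decrease condition for the model $m_k$ of $f_N$ and the standard acceptance rule $f_N(x_k)-f_N(x_k+p_k)\ge\eta\,(m_k(0)-m_k(p_k))$), and (i) $\liminf_{k\to\infty}\|\nabla f_N(x_k)\|=0$; (ii) $\lim_{k\to\infty}\|\nabla f_N(x_k)\|=0$, provided that $f_N$ is Lipschitz continuous in $\Omega$.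
   Context: Problem. Let $N,n\ge 1$ be integers and $\phi_1,\dots,\phi_N:\mathbb R^n\to\mathbb R$ continuously differentiable. For a nonempty $I_M\subseteq\{1,\dots,N\}$ with $|I_M|=M$ put $f_M(x)=\frac1M\sum_{i\in I_M}\phi_i(x)$; $f_N$ is the full average, to be minimized over $\mathbb R^n$. $\|\cdot\|$ is the Euclidean (operator 2-) norm. $h:\mathbb N\to\mathbb R$ measures infeasibility with respect to the constraint $M=N$. Algorithm IRETR. Data: $x_0\in\mathbb R^n$, an integer $N_0\in(0,N]$, $\theta_0\in(0,1)$, $\Delta_0>0$, $0<\zeta_1<1<\zeta_2$, $\gamma\in(0,1]$, $r,\eta,\tau\in(0,1)$, $\mu\in[0,1)$, $\varepsilon_g\ge0$. Step 0. Set $k=0$, $\mathcal T_0=0$, $\Delta_0^{(0)}=\Delta_0$. Step 1. If $N_k<N$, find an integer $\widetilde N_{k+1}$ with $N_k<\widetilde N_{k+1}\le N$ and $h(\widetilde N_{k+1})\le r\,h(N_k)$. If $N_k=N$, set $\widetilde N_{k+1}=N$. Step 2. Choose an integer $1\le N_{k+1}\le\widetilde N_{k+1}$ with $h(N_{k+1})-h(\widetilde N_{k+1})\le\mu(\Delta_k^{(\mathcal T_k)})^{1+\gamma}$ and a sample $I_{N_{k+1}}$. If $N_k=N$ and $\|\nabla f_{N_{k+1}}(x_k)\|\le\varepsilon_g$, stop. Build the model $m_k(p)=f_{N_{k+1}}(x_k)+\nabla f_{N_{k+1}}(x_k)^Tp+\frac12p^TB_{k+1}p$ with $B_{k+1}\in\mathbb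 R^{n\times n}$ symmetric (possibly zero). Find $p_k$ with $\|p_k\|\le\Delta_k^{(\mathcal T_k)}$ and $m_k(0)-m_k(p_k)\ge\tau(m_k(0)-m_k(p_k^C))$ (Cauchy decrease condition), where the Cauchy step $p_k^C$ minimizes $m_k$ over $\{p=-t\nabla f_{N_{k+1}}(x_k):\ t>0,\ \|p\|\le\Delta_k^{(\mathcal T_k)}\}$. Step 3. If $N_k=N$, $N_{k+1}<N$ and $f_N(x_k)-m_k(p_k)<\tau(m_k(0)-m_k(p_k^C))$, set $\Delta_k^{(\mathcal T_k+1)}=\zeta_1\Delta_k^{(\mathcal T_k)}$, $\mathcal T_k=\mathcal T_k+1$ and repeat Step 2. Step 4. Set $\theta_{k+1}=\theta_k$ if $\mathrm{Pred}_k(\theta_k)\ge\eta(h(N_k)-h(\widetilde N_{k+1}))$; otherwise $\theta_{k+1}=\dfrac{(1-\eta)(h(N_k)-h(\widetilde N_{k+1}))}{m_k(p_k)-f_{N_k}(x_k)+h(N_k)-h(\widetilde N_{k+1})}$. Step 5. If $\mathrm{Ared}_k(\theta_{k+1})\ge\eta\,\mathrm{Pred}_k(\theta_{k+1})$, set $x_{k+1}=x_k+p_k$, $\Delta_k=\Delta_k^{(\mathcal T_k)}$, choose $\Delta_{k+1}^{(0)}\in[\Delta_k,\zeta_2\Delta_k]$, set $k=k+1$, $\mathcal T_k=0$ and go to Step 1. Otherwise set $\Delta_k^{(\mathcal T_k+1)}=\zeta_1\Delta_k^{(\mathcal T_k)}$, $\mathcal T_k=\mathcal T_k+1$ and go to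 Step 2. Here $\mathrm{Pred}_k(\theta)=\theta(f_{N_k}(x_k)-m_k(p_k))+(1-\theta)(h(N_k)-h(\widetilde N_{k+1}))$ and $\mathrm{Ared}_k(\theta)=\theta(f_{N_k}(x_k)-f_{N_{k+1}}(x_k+p_k))+(1-\theta)(h(N_k)-h(N_{k+1}))$. Iteration $k$ ends when the step is accepted in Step 5; $N_{k+1},\theta_{k+1},p_k,m_k$ without further specification are the values at acceptance, and $f_{N_k}$ uses the sample accepted at the end of iteration $k-1$. *)

(* Defs.v *)
From HB Require Import structures.
From mathcomp Require Import all_boot all_order all_algebra.
From mathcomp Require Import all_classical all_reals all_analysis.

Set Implicit Arguments.
Unset Strict Implicit.
Unset Printing Implicit Defensive.

Import Order.TTheory GRing.Theory Num.Theory.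
Import numFieldNormedType.Exports.

Local Open Scope classical_set_scope.
Local Open Scope ring_scope.

Section Euclidean.
Variables (R : realType) (n : nat).
Implicit Types (u v x p g : 'cV[R]_n) (B : 'M[R]_n) (f : 'cV[R]_n -> R).

Definition dot u v : R := (u^T *m v) 0 0.

(* The library norm `|v| on 'cV[R]_n is the max norm, which induces the same
   topology; every norm in the algorithm and in the hypotheses is enorm. *)
Definition enorm v : R := Num.sqrt (dot v v).

Definition opnorm B : R := sup [set enorm (B *m v) | v in [set v | enorm v <= 1]].

Definition grad f x : 'cV[R]_n := \col_i 'D_(delta_mx i 0) f x.

Definition cont_differentiable f : Prop :=
  (forall x, differentiable f x) /\ continuous (grad f).

Definition segment x y : set 'cV[R]_n :=
  [set x + t *: (y - x) | t in [set t : R | 0 <= t <= 1]].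

Definition lipschitz_fun_on (A : set 'cV[R]_n) f : Prop :=
  exists C : R, forall x y, A x -> A y -> `|f x - f y| <= C * enorm (x - y).

Definition lipschitz_grad_on (L : R) (A : set 'cV[R]_n) f : Prop :=
  forall x y, A x -> A y -> enorm (grad f x - grad f y) <= L * enorm (x - y).

Definition model f x B p : R :=
  f x + dot (grad f x) p + 2^-1 * dot p (B *m p).

Definition cauchy_arc g (Delta : R) : set 'cV[R]_n :=
  [set p | (exists2 t : R, 0 < t & p = - t *: g) /\ enorm p <= Delta].

Definition is_cauchy_step f x B (Delta : R) (pC : 'cV[R]_n) : Prop :=
  cauchy_arc (grad f x) Delta pC /\
  forall q, cauchy_arc (grad f x) Delta q -> model f x B pC <= model f x B q.

Definition cauchy_decrease f x B (tau : R) (pC p : 'cV[R]_n) : Prop :=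
  tau * (model f x B 0 - model f x B pC) <= model f x B 0 - model f x B p.

Definition trust_region_step f (eta tau : R) x (Delta : R) B pC p x' : Prop :=
  [/\ B^T = B,
      enorm p <= Delta,
      is_cauchy_step f x B Delta pC /\ cauchy_decrease f x B tau pC p,
      eta * (model f x B 0 - model f x B p) <= f x - f (x + p)
    & x' = x + p].

End Euclidean.

Section IRETR.
Variables (R : realType) (N n : nat).

Record iretr_data := IretrData {
  d_x0 : 'cV[R]_n;
  d_N0 : nat;
  d_theta0 : R;
  d_Delta0 : R;
  d_zeta1 : R;
  d_zeta2 : R;
  d_gamma : R;
  d_r : R;
  d_eta : R;
  d_tau : R;
  d_mu : R;
  d_epsg : R }.

Definition valid_data (D : iretr_data) : Prop :=
  [/\ (0 < d_N0 D <= N)%N,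
      0 < d_theta0 D < 1,
      0 < d_Delta0 D,
      0 < d_zeta1 D < 1 /\ 1 < d_zeta2 D
    & 0 < d_gamma D <= 1] /\
  [/\ 0 < d_r D < 1,
      0 < d_eta D < 1,
      0 < d_tau D < 1,
      0 <= d_mu D < 1
    & 0 <= d_epsg D].

(* The variables of the algorithm on entry to Step 2: k, T_k, x_k, I_{N_k},
   theta_k, Ntilde_{k+1}, Delta_k^(T_k). *)
Record state := State {
  s_k : nat;
  s_T : nat;
  s_x : 'cV[R]_n;
  s_I : {set 'I_N};
  s_theta : R;
  s_Nt : nat;
  s_Delta : R }.

(* What one pass through Step 2 selects: I_{N_{k+1}}, B_{k+1}, p_k^C, p_k. *)
Record trial := Trial {
  t_I : {set 'I_N};
  t_B : 'M[R]_n;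
  t_pC : 'cV[R]_n;
  t_p : 'cV[R]_n }.

(* N_k and N_{k+1} are the sizes of the selected samples. *)
Definition s_N (s : state) : nat := #|s_I s|.
Definition t_N (t : trial) : nat := #|t_I t|.

Variables (phi : 'I_N -> 'cV[R]_n -> R) (h : nat -> R) (D : iretr_data).
Implicit Types (I : {set 'I_N}) (s : state) (t : trial).

Definition favg I (x : 'cV[R]_n) : R := #|I|%:R^-1 * \sum_(i in I) phi i x.
Definition ffull : 'cV[R]_n -> R := favg [set: 'I_N].

Definition mk s t (p : 'cV[R]_n) : R := model (favg (t_I t)) (s_x s) (t_B t) p.

Definition pred_red s t (theta : R) : R :=
  theta * (favg (s_I s) (s_x s) - mk s t (t_p t))
  + (1 - theta) * (h (s_N s) - h (s_Nt s)).

Definition ared s t (theta : R) : R :=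
  theta * (favg (s_I s) (s_x s) - favg (t_I t) (s_x s + t_p t))
  + (1 - theta) * (h (s_N s) - h (t_N t)).

Definition step1 (Nk Nt : nat) : Prop :=
  if (Nk < N)%N then (Nk < Nt <= N)%N /\ h Nt <= d_r D * h Nk else Nt = N.

Definition initial s : Prop :=
  [/\ s_k s = 0%N, s_T s = 0%N, s_x s = d_x0 D, s_N s = d_N0 D
    & s_theta s = d_theta0 D] /\
  [/\ s_Delta s = d_Delta0 D & step1 (s_N s) (s_Nt s)].

Definition stops s t : bool :=
  (s_N s == N) && (enorm (grad (favg (t_I t)) (s_x s)) <= d_epsg D).

Definition step2_sample s t : Prop :=
  (1 <= t_N t <= s_Nt s)%N /\
  h (t_N t) - h (s_Nt s) <= d_mu D * (s_Delta s) `^ (1 + d_gamma D).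

Definition step2_model s t : Prop :=
  [/\ (t_B t)^T = t_B t,
      is_cauchy_step (favg (t_I t)) (s_x s) (t_B t) (s_Delta s) (t_pC t),
      enorm (t_p t) <= s_Delta s
    & cauchy_decrease (favg (t_I t)) (s_x s) (t_B t) (d_tau D) (t_pC t) (t_p t)].

Definition step3_rejects s t : bool :=
  [&& s_N s == N, (t_N t < N)%N
    & ffull (s_x s) - mk s t (t_p t) < d_tau D * (mk s t 0 - mk s t (t_pC t))].

Definition step4_theta s t : R :=
  if d_eta D * (h (s_N s) - h (s_Nt s)) <= pred_red s t (s_theta s)
  then s_theta s
  else (1 - d_eta D) * (h (s_N s) - h (s_Nt s)) /
       (mk s t (t_p t) - favg (s_I s) (s_x s) + h (s_N s) - h (s_Nt s)).

Definition accepted s t : bool :=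
  ~~ step3_rejects s t &&
  (d_eta D * pred_red s t (step4_theta s t) <= ared s t (step4_theta s t)).

(* Rejection, in Step 3 or in Step 5, returns to Step 2 with a smaller radius;
   acceptance starts iteration k+1, including its Step 1. *)
Definition update s t s' : Prop :=
  if accepted s t then
    [/\ s_k s' = (s_k s).+1, s_T s' = 0%N, s_x s' = s_x s + t_p t,
        s_I s' = t_I t & s_theta s' = step4_theta s t] /\
    [/\ step1 (s_N s') (s_Nt s')
      & s_Delta s <= s_Delta s' <= d_zeta2 D * s_Delta s]
  else s' = State (s_k s) (s_T s).+1 (s_x s) (s_I s) (s_theta s) (s_Nt s)
              (d_zeta1 D * s_Delta s).

(* A run that never stops, recorded as the infinite sequence of all passes
   through Step 2, accepted or not. Termination of the inner repetitions is not
   assumed. *)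
Definition infinite_run (s : nat -> state) (t : nat -> trial) : Prop :=
  initial (s 0%N) /\
  forall j, [/\ step2_sample (s j) (t j), ~~ stops (s j) (t j),
                step2_model (s j) (t j) & update (s j) (t j) (s j.+1)].

(* Pass j is the one at which iteration k ends. *)
Definition ends_iteration (s : nat -> state) (t : nat -> trial) (k j : nat) : Prop :=
  s_k (s j) = k /\ accepted (s j) (t j).

End IRETR.

(* Main.v *)
(** Along the run [theta_k] is nonincreasing and, since [f] is bounded on
    [Omega] and [m_k(p_k) <= f_{N_{k+1}}(x_k)], bounded below by a positive
    constant.  The merit function
    [f_{N_k}(x_k) + (1/theta_k - 1) (h(N_k) - h(0))] is bounded below and drops
    at iteration [k] by at least [eta^2 (h(N_k) - h(Ntilde_{k+1}))], which is
    bounded away from 0 while [N_k < N]; hence [N_k = N] from some [k] on, and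
    the iterations are trust-region steps on [f_N].  If the gradients stayed
    above [e > 0], so would the radii stay above some positive constant, and the
    Cauchy decrease would make [f_N] unbounded below: this gives the liminf.
    For the limit, [|g_k| - |g_{k+1}| <= L Delta_k] by the Lipschitz bound on the
    steps, while [Delta_k] is at most a multiple of [f_N(x_k) - f_N(x_{k+1})] as
    long as [|g_k| >= e]; since [f_N(x_k)] converges, a late gradient of norm
    [2e] would keep all later ones above [e], contradicting the liminf. *)

Require Import Defs.
From HB Require Import structures.
From mathcomp Require Import all_boot all_order all_algebra.
From mathcomp Require Import all_classical all_reals all_analysis.
From mathcomp Require Import ring lra.
Import Order.TTheory GRing.Theory Num.Theory.
Import numFieldNormedType.Exports.
Local Open Scope classical_set_scope.
Local Open Scope ring_scope.

(** * Euclidean norm, Cauchy step and first-order Taylor bound *)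

Section Euclidean.
Context {R : realType} {n : nat}.
Implicit Types (u v w x p g : 'cV[R]_n) (B : 'M[R]_n) (f : 'cV[R]_n -> R).

Lemma dotE u v : dot u v = \sum_i u i 0 * v i 0.
Proof. by rewrite /dot mxE; apply: eq_bigr => i _; rewrite mxE. Qed.

Lemma dotC u v : dot u v = dot v u.
Proof. by rewrite !dotE; apply: eq_bigr => i _; rewrite mulrC. Qed.

Lemma dotDr u v w : dot u (v + w) = dot u v + dot u w.
Proof. by rewrite /dot mulmxDr mxE. Qed.

Lemma dotZr (a : R) u v : dot u (a *: v) = a * dot u v.
Proof. by rewrite /dot -scalemxAr mxE. Qed.

Lemma dotNr u v : dot u (- v) = - dot u v.
Proof. by rewrite -scaleN1r dotZr mulN1r. Qed.

Lemma dotDl u v w : dot (u + v) w = dot u w + dot v w.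
Proof. by rewrite !(dotC _ w) dotDr. Qed.

Lemma dotZl (a : R) u v : dot (a *: u) v = a * dot u v.
Proof. by rewrite !(dotC _ v) dotZr. Qed.

Lemma dotNl u v : dot (- u) v = - dot u v.
Proof. by rewrite !(dotC _ v) dotNr. Qed.

Lemma dot0l u : dot 0 u = 0.
Proof. by rewrite -(scale0r 0) dotZl mul0r. Qed.

Lemma dot0r u : dot u 0 = 0.
Proof. by rewrite dotC dot0l. Qed.

Lemma dot_ge0 u : 0 <= dot u u.
Proof. by rewrite dotE; apply: sumr_ge0 => i _; rewrite -expr2 sqr_ge0. Qed.

Lemma enorm_ge0 u : 0 <= enorm u.
Proof. exact: sqrtr_ge0. Qed.

Lemma enorm_sqr u : enorm u ^+ 2 = dot u u.
Proof. by rewrite sqr_sqrtr// dot_ge0. Qed.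

Lemma enorm0 : enorm (0 : 'cV[R]_n) = 0.
Proof. by rewrite /enorm dot0l sqrtr0. Qed.

Lemma enorm_eq0 u : enorm u = 0 -> u = 0.
Proof.
move=> u0; have := enorm_sqr u; rewrite u0 expr0n/= dotE => /esym/eqP.
rewrite psumr_eq0; last by move=> i _; rewrite -expr2 sqr_ge0.
move=> /allP uz; apply/colP => i; rewrite mxE; apply/eqP.
by have := uz i (mem_index_enum _); rewrite -expr2 sqrf_eq0.
Qed.

Lemma enormZ (a : R) u : enorm (a *: u) = `|a| * enorm u.
Proof.
by rewrite /enorm dotZl dotZr mulrA -expr2 sqrtrM ?sqr_ge0// sqrtr_sqr.
Qed.

Lemma enormN u : enorm (- u) = enorm u.
Proof. by rewrite -scaleN1r enormZ normrN1 mul1r. Qed.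

Lemma cauchy_schwarz u v : `|dot u v| <= enorm u * enorm v.
Proof.
have [v0|v0] := eqVneq (enorm v) 0.
  by rewrite (enorm_eq0 v v0) dot0r normr0 enorm0 mulr0.
have vgt0 : 0 < enorm v by rewrite lt_neqAle eq_sym v0 enorm_ge0.
rewrite -ler_sqr ?nnegrE ?mulr_ge0 ?enorm_ge0//.
rewrite real_normK ?num_real// exprMn !enorm_sqr.
have v2 : 0 < dot v v by rewrite -enorm_sqr exprn_gt0.
(* The squared norm of this vector is [dot v v] times the Cauchy-Schwarz defect; the scaling avoids
   a division. *)
have := dot_ge0 (dot v v *: u - dot u v *: v).
rewrite !(dotDl, dotDr, dotNl, dotNr, dotZl, dotZr) (dotC v u).
set a := dot u v; set b := dot v v; set c := dot u u => H.
have : 0 <= b * (c * b - a ^+ 2) by apply: le_trans H _; lra.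
by rewrite pmulr_rge0// subr_ge0.
Qed.

Lemma dot_le u v : dot u v <= enorm u * enorm v.
Proof. exact: le_trans (ler_norm _) (cauchy_schwarz u v). Qed.

Lemma enormD u v : enorm (u + v) <= enorm u + enorm v.
Proof.
rewrite -ler_sqr ?nnegrE ?addr_ge0 ?enorm_ge0//.
rewrite sqrrD !enorm_sqr !(dotDl, dotDr) (dotC v u).
have := dot_le u v; lra.
Qed.

Lemma enorm_sum (I : Type) (r : seq I) (P : pred I) (F : I -> 'cV[R]_n) :
  enorm (\sum_(i <- r | P i) F i) <= \sum_(i <- r | P i) enorm (F i).
Proof.
elim/big_ind2 : _ => //; first by rewrite enorm0.
by move=> u a v b ua vb; apply: le_trans (enormD _ _) _; exact: lerD.
Qed.

Lemma ler_dist_enorm u v : enorm u - enorm v <= enorm (u - v).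
Proof. by rewrite lerBlDr -{1}(subrK v u) enormD. Qed.

Lemma normr_coord_le u i : `|u i 0| <= enorm u.
Proof.
rewrite -ler_sqr ?nnegrE ?enorm_ge0// real_normK ?num_real// enorm_sqr dotE.
rewrite (bigD1 i)//= -expr2 lerDl.
by apply: sumr_ge0 => j _; rewrite -expr2 sqr_ge0.
Qed.

Lemma col_sum_delta u : u = \sum_i u i 0 *: delta_mx i 0.
Proof. by rewrite {1}[u]matrix_sum_delta; apply: eq_bigr => i _; rewrite big_ord1. Qed.

Lemma enorm_le_sum u : enorm u <= \sum_i `|u i 0|.
Proof.
rewrite {1}(col_sum_delta u).
apply: le_trans (enorm_sum _ _ _ _) _; apply: ler_sum => i _.
rewrite enormZ (_ : enorm _ = 1) ?mulr1//.
rewrite /enorm dotE (bigD1 i)//= !mxE !eqxx mulr1 big1 ?addr0 ?sqrtr1//.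
by move=> j ji; rewrite !mxE (negbTE ji) mul0r.
Qed.

(* The supremum defining [opnorm] is meaningful only on a bounded set. *)
Lemma opnorm_has_ubound B :
  has_ubound [set enorm (B *m v) | v in [set v | enorm v <= 1]].
Proof.
exists (\sum_i \sum_j `|B i j|) => _ [v /= v1 <-].
apply: le_trans (enorm_le_sum _) _; apply: ler_sum => i _.
rewrite mxE; apply: le_trans (ler_norm_sum _ _ _) _; apply: ler_sum => j _.
rewrite normrM ler_piMr//.
exact: le_trans (normr_coord_le v j) v1.
Qed.

Lemma enorm_mulmx_le B v : enorm (B *m v) <= opnorm B * enorm v.
Proof.
have [v0|v0] := eqVneq (enorm v) 0.
  by rewrite (enorm_eq0 v v0) mulmx0 enorm0 mulr0.
have vgt0 : 0 < enorm v by rewrite lt_neqAle eq_sym v0 enorm_ge0.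
rewrite -ler_pdivrMr//.
apply: (ub_le_sup (opnorm_has_ubound B)).
exists ((enorm v)^-1 *: v) => /=.
  by rewrite enormZ ger0_norm ?invr_ge0 ?enorm_ge0// mulVf.
by rewrite -scalemxAr enormZ ger0_norm ?invr_ge0 ?enorm_ge0// mulrC.
Qed.

Lemma quad_form_le B p (kappa : R) :
  opnorm B <= kappa -> `|dot p (B *m p)| <= kappa * enorm p ^+ 2.
Proof.
move=> Bk; apply: le_trans (cauchy_schwarz _ _) _.
rewrite expr2 mulrA mulrC ler_wpM2r ?enorm_ge0//.
by apply: le_trans (enorm_mulmx_le _ _) _; rewrite ler_wpM2r ?enorm_ge0.
Qed.

Lemma model0 f x B : model f x B 0 = f x.
Proof. by rewrite /model !dot0l dot0r mulr0 !addr0. Qed.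

(** The Cauchy point is compared with the step of length [a = min(Delta, |g| / kappa)] along [-g]:
    the linear gain is [a |g|], and the curvature takes back at most
    [kappa a^2 / 2 <= a |g| / 2]. *)
Lemma cauchy_step_decrease f x B (Delta kappa : R) pC :
  0 < Delta -> 0 < kappa -> opnorm B <= kappa ->
  is_cauchy_step f x B Delta pC ->
  2^-1 * enorm (grad f x) * Num.min Delta (enorm (grad f x) / kappa)
    <= model f x B 0 - model f x B pC.
Proof.
move=> D0 k0 Bk [[[t t0 pCE] _] pCmin].
(* For a zero gradient the arc reduces to the origin and both sides vanish. *)
have [g0|g0] := eqVneq (enorm (grad f x)) 0.
  by rewrite g0 mulr0 mul0r pCE (enorm_eq0 _ g0) scaler0 subrr.
set g := grad f x in g0 pCE *.
have ggt0 : 0 < enorm g by rewrite lt_neqAle eq_sym g0 enorm_ge0.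
pose a := Num.min Delta (enorm g / kappa).
have a0 : 0 < a by rewrite lt_min D0 divr_gt0.
have aD : a <= Delta by rewrite ge_min lexx.
have ak : a * kappa <= enorm g by rewrite -ler_pdivlMr// ge_min lexx orbT.
have /pCmin : cauchy_arc (grad f x) Delta (- (a / enorm g) *: g).
  split; first by exists (a / enorm g) => //; exact: divr_gt0.
  by rewrite enormZ normrN gtr0_norm ?divfK// divr_gt0.
rewrite model0 {2}/model -/g -scalemxAr dotZr dotZl dotZr -enorm_sqr.
have := quad_form_le B g kappa Bk; rewrite ler_norml => /andP[_ Q].
set q := dot g _ in Q *; set G := enorm g in a0 ak Q ggt0 *.
rewrite -/a.
have e1 : a / G * G ^+ 2 = a * G by field; rewrite gt_eqF.
have e2 : (a / G) ^+ 2 * q <= a * G.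
  apply: (@le_trans _ _ ((a / G) ^+ 2 * (kappa * G ^+ 2))).
    by rewrite ler_wpM2l ?sqr_ge0.
  rewrite (_ : _ * _ = a * (a * kappa)); last by field; rewrite gt_eqF.
  by rewrite ler_wpM2l// ltW.
have e3 (z : R) : - z * (- z * q) = z ^+ 2 * q by ring.
rewrite e3 mulNr e1; lra.
Qed.

Lemma is_derive_line f x p (c : R) : derivable f (x + c *: p) p ->
  is_derive c 1 (fun a => f (x + a *: p)) ('D_p f (x + c *: p)).
Proof.
rewrite /derivable => df.
have E : (fun h : R => h^-1 *: (((fun a => f (x + a *: p)) \o shift c) (h *: 1) -
    f (x + c *: p))) =
  (fun h : R => h^-1 *: ((f \o shift (x + c *: p)) (h *: p) - f (x + c *: p))).
  apply/funext => h /=; congr (_ *: (f _ - _)).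
  by rewrite [h *: 1]mulr1 scalerDl addrCA.
by split; rewrite /derivable /derive E.
Qed.

Lemma derive_grad f x p : differentiable f x -> 'D_p f x = dot (grad f x) p.
Proof.
move=> df; rewrite deriveE// dotE.
rewrite {1}(col_sum_delta p).
rewrite linear_sum; apply: eq_bigr => i _.
by rewrite linearZ/= mxE deriveE// mulrC.
Qed.

Lemma mean_value_line f x p : (forall y, differentiable f y) ->
  exists2 c : R, 0 <= c <= 1 & f (x + p) - f x = dot (grad f (x + c *: p)) p.
Proof.
move=> df; pose phi a := f (x + a *: p).
have dphi (c : R) : is_derive c (1 : R) phi (dot (grad f (x + c *: p)) p).
  by rewrite -derive_grad//; apply: is_derive_line; exact: diff_derivable.
have cphi : {within `[0, 1], continuous phi}.
  apply/continuous_subspaceT => c; apply/differentiable_continuous.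
  exact/derivable1_diffP.
have [c] := @MVT_segment R phi _ 0 1 ler01 (fun c _ => dphi c) cphi.
rewrite in_itv/= => c01; rewrite /phi scale1r scale0r addr0 subr0 mulr1.
by exists c.
Qed.

(** The gradient at a mean-value point of the segment is compared with the one at [x]. This gives
    [L] instead of the sharp [L / 2], which is enough for all later estimates. *)
Lemma taylor_bound f x p (L : R) : (forall y, differentiable f y) ->
  0 <= L -> lipschitz_grad_on L (segment x (x + p)) f ->
  `|f (x + p) - f x - dot (grad f x) p| <= L * enorm p ^+ 2.
Proof.
move=> df L0 lip; have [c c01 ->] := mean_value_line f x p df.
have /andP[c0 c1] := c01.
rewrite -dotNl -dotDl; apply: le_trans (cauchy_schwarz _ _) _.
rewrite expr2 mulrA ler_wpM2r ?enorm_ge0//.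
apply: le_trans (lip _ _ _ _) _.
- by exists c => //; rewrite addrAC subrr add0r.
- by exists 0; rewrite /= ?lexx ?ler01// scale0r addr0.
rewrite addrAC subrr add0r enormZ ger0_norm//.
by rewrite ler_wpM2l// ler_piMl ?enorm_ge0.
Qed.

End Euclidean.

(** * Monotone real sequences and lower limits *)

Section RealSequences.
Context {R : realType}.

(** Take [K] with [w K] within [e] of the infimum: all later values lie between the two. *)
Lemma nonincreasing_tail (w : nat -> R) (m : R) (K0 : nat) :
  (forall k, m <= w k) -> (forall k, (K0 <= k)%N -> w k.+1 <= w k) ->
  forall e, 0 < e ->
  exists K, forall k l, (K <= k)%N -> (k <= l)%N -> w k - w l < e.
Proof.
move=> mw dw e e0.
have mono k l : (K0 <= k)%N -> (k <= l)%N -> w l <= w k.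
  move=> Kk; elim: l => [|l IH]; first by rewrite leqn0 => /eqP ->.
  rewrite leq_eqVlt => /predU1P[-> //|]; rewrite ltnS => kl.
  by apply: le_trans (IH kl); apply: dw; exact: leq_trans kl.
pose A := [set w k | k in [set k | (K0 <= k)%N]].
have infA : has_inf A.
  by split; [exists (w K0); exists K0 => /=|exists m => _ [k _ <-]].
have [_ [K /= K0K <-] wK] := inf_adherent e0 infA.
exists K => k l Kk kl.
have : inf A <= w l.
  apply: ge_inf; first by case: infA.
  by exists l => //=; rewrite (leq_trans K0K)// (leq_trans Kk).
have : w k <= w K by apply: mono.
lra.
Qed.

Lemma bounded_drops (w : nat -> R) (m c : R) (P : nat -> Prop) :
  (forall k, m <= w k) -> (forall k, w k.+1 <= w k) -> 0 < c ->
  (forall k, P k -> w k.+1 <= w k - c) ->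
  exists K, forall k, (K <= k)%N -> ~ P k.
Proof.
move=> mw dw c0 dP.
have [K HK] := nonincreasing_tail w m 0 mw (fun k _ => dw k) c c0.
by exists K => k Kk /dP; have := HK k k.+1 Kk (leqnSn k); lra.
Qed.

(** Every tail has infimum 0, so the sequence of tail infima is constant. *)
Lemma limn_einf_eq0 (u : nat -> R) : (forall k, 0 <= u k) ->
  (forall e K, 0 < e -> exists2 k, (K <= k)%N & u k < e) ->
  limn_einf (fun k => (u k)%:E) = 0%E.
Proof.
move=> u0 small; rewrite limn_einf_lim.
have -> : einfs (fun k => (u k)%:E) = cst 0%E.
  apply/funext => K; apply/eqP; rewrite eq_le; apply/andP; split.
    apply/lee_addgt0Pr => e e0; rewrite add0e.
    have [k Kk uk] := small e K e0.
    apply: le_trans (_ : (u k)%:E <= _)%E; last by rewrite lee_fin ltW.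
    by apply: ereal_inf_lbound; exists k.
  by apply: le_ereal_inf_tmp => _ [k _ <-]; rewrite lee_fin.
exact: lim_cst.
Qed.

End RealSequences.

(** * Differentiability and bounds for sample averages *)

Section Averages.
Context {R : realType} {N n : nat}.
Context {phi : 'I_N -> 'cV[R]_n -> R}.
Hypothesis dphi : forall i x, differentiable (phi i) x.
Implicit Types (I : {set 'I_N}) (x : 'cV[R]_n).

(** A scaled sum of functions over all indices is the shape to which the differentiation rules
    apply. *)
Lemma favgE I : favg phi I =
  #|I|%:R^-1 \*: (\sum_i (if i \in I then phi i else cst 0)).
Proof.
apply/funext => x; rewrite /favg /= fct_sumE big_mkcond/=; congr (_ * _).
by apply: eq_bigr => i _; case: ifP.
Qed.

Lemma differentiable_favg I x : differentiable (favg phi I) x.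
Proof.
rewrite favgE; apply: differentiableZ; apply: differentiable_sum => i.
by case: ifP.
Qed.

Lemma grad_favg I x :
  grad (favg phi I) x = #|I|%:R^-1 *: \sum_(i in I) grad (phi i) x.
Proof.
have df i v : derivable (if i \in I then phi i else cst 0) x v.
  by case: ifP => _ //; exact: diff_derivable.
apply/colP => j; rewrite !mxE favgE deriveZ; last exact: derivable_sum.
rewrite derive_sum// summxE [in RHS]big_mkcond/=; congr (_ * _).
by apply: eq_bigr => i _; case: ifP; rewrite ?mxE// derive_cst.
Qed.

Lemma avg_le I (F : 'I_N -> R) (C : R) : 0 <= C ->
  (forall i, F i <= C) -> #|I|%:R^-1 * \sum_(i in I) F i <= C.
Proof.
(* For an empty sample the inverse of 0 is 0, so the average is 0 and [0 <= C] decides. *)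
move=> C0 FC; have [->|I0] := eqVneq #|I| 0%N; first by rewrite invr0 mul0r.
rewrite mulrC ler_pdivrMr ?ltr0n ?lt0n//.
apply: le_trans (ler_sum _ (fun i _ => FC i)) _.
by rewrite sumr_const mulr_natr.
Qed.

Lemma lipschitz_grad_favg I (L : R) (A : set 'cV[R]_n) : 0 <= L ->
  (forall i, lipschitz_grad_on L A (phi i)) -> lipschitz_grad_on L A (favg phi I).
Proof.
move=> L0 lip x y Ax Ay; rewrite !grad_favg -scalerBr -sumrB enormZ.
rewrite ger0_norm ?invr_ge0//.
apply: le_trans (_ : #|I|%:R^-1 * \sum_(i in I) _ <= _); last first.
  apply: (@avg_le I _ (L * enorm (x - y))); first by rewrite mulr_ge0 ?enorm_ge0.
  by move=> i; exact: lip.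
by rewrite ler_wpM2l ?invr_ge0// enorm_sum.
Qed.

(** Bounds for the single [phi i] on the compact set, added up, serve all samples at once. *)
Lemma favg_bounded (A : set 'cV[R]_n) : compact A ->
  exists2 F : R, 0 <= F & forall I x, A x -> `|favg phi I x| <= F.
Proof.
move=> cA.
have bnd i : exists F : R, forall x, A x -> `|phi i x| <= F.
  have cphi : {within A, continuous (phi i)}.
    by apply: continuous_subspaceT => x; exact: differentiable_continuous.
  have [M [_ HM]] := compact_bounded (continuous_compact cphi cA).
  exists (M + 1) => x Ax; apply: (HM (M + 1)); first by rewrite ltrDl.
  by exists x.
have [F HF] := choice bnd.
exists (\sum_i `|F i|) => [|I x Ax]; first exact: sumr_ge0.
rewrite /favg normrM ger0_norm ?invr_ge0//.
apply: le_trans (_ : #|I|%:R^-1 * \sum_(i in I) `|phi i x| <= _).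
  by rewrite ler_wpM2l ?invr_ge0// ler_norm_sum.
apply: avg_le => [|i]; first exact: sumr_ge0.
apply: le_trans (HF i x Ax) _; apply: le_trans (ler_norm _) _.
by rewrite (bigD1 i)//= lerDl sumr_ge0.
Qed.

End Averages.

(** * Elementary estimates at a single pass of the run *)

Section Run.
Context {R : realType} {N n : nat}.
Context {phi : 'I_N -> 'cV[R]_n -> R} {h : nat -> R} {D : iretr_data R n}.
Hypotheses (dphi : forall i x, differentiable (phi i) x)
  (hD : valid_data N D) (heps : d_epsg D = 0).
Context {s : nat -> state R N n} {t : nat -> trial R N n}.
Hypothesis hrun : infinite_run phi h D s t.
Hypotheses (h_decr : forall i j : nat, (i < j)%N -> h j < h i)
  (N_gt0 : (0 < N)%N) (h_N : h N = 0).
Context {L kappa F : R}.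
Hypotheses (L_ge0 : 0 <= L)
  (hL : forall i j,
     lipschitz_grad_on L (segment (s_x (s j)) (s_x (s j) + t_p (t j))) (phi i))
  (kappa_gt0 : 0 < kappa) (hB : forall j, opnorm (t_B (t j)) <= kappa)
  (F_ge0 : 0 <= F) (hF : forall I j, `|favg phi I (s_x (s j))| <= F).

Local Notation eta := (d_eta D).
Local Notation tau := (d_tau D).
Local Notation acpt j := (accepted phi h D (s j) (t j)).
Local Notation "'theta'' j" := (step4_theta phi h D (s j) (t j)) (at level 10).
Local Notation gradN j := (enorm (grad (ffull phi) (s_x (s j)))).
Local Notation modelf j := (mk phi (s j) (t j)).
Local Notation fk j := (favg phi (s_I (s j)) (s_x (s j))).
Local Notation hgap j := (h (s_N (s j)) - h (s_Nt (s j))).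

(** As [h] decreases strictly, this is the least infeasibility of an incomplete sample. *)
Let hmin := h N.-1.
(** The model error constant: [L] from the Taylor remainder, [kappa / 2] from the quadratic term. *)
Let C := L + 2^-1 * kappa.

Lemma eta_bounds : 0 < eta < 1. Proof. by case: hD => _ []. Qed.
Lemma tau_bounds : 0 < tau < 1. Proof. by case: hD => _ []. Qed.
Lemma r_bounds : 0 < d_r D < 1. Proof. by case: hD => _ []. Qed.
Lemma zeta1_bounds : 0 < d_zeta1 D < 1. Proof. by case: hD => -[_ _ _ []]. Qed.

Lemma C_gt0 : 0 < C.
Proof. by rewrite ltr_wpDl// mulr_gt0// invr_gt0. Qed.

Lemma h_mono i j : (i <= j)%N -> h j <= h i.
Proof. by rewrite leq_eqVlt => /predU1P[-> //|/h_decr/ltW]. Qed.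

Lemma hmin_gt0 : 0 < hmin.
Proof. by rewrite -h_N; apply: h_decr; rewrite ltn_predL. Qed.

Lemma h0_gt0 : 0 < h 0%N.
Proof. by rewrite -h_N; exact: h_decr. Qed.

Lemma h_ge_hmin m : (m < N)%N -> hmin <= h m.
Proof. by move=> mN; apply: h_mono; rewrite -ltnS prednK. Qed.

Lemma card_le_N (I : {set 'I_N}) : (#|I| <= N)%N.
Proof. by rewrite -[leqRHS]card_ord max_card. Qed.

Lemma sample_full (I : {set 'I_N}) : #|I| = N -> I = [set: 'I_N]%SET.
Proof. by move=> IN; apply/eqP; rewrite eqEcard finset.subsetT cardsT card_ord IN/=. Qed.

Lemma update_accepted j : acpt j ->
  [/\ s_k (s j.+1) = (s_k (s j)).+1, s_x (s j.+1) = s_x (s j) + t_p (t j),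
      s_I (s j.+1) = t_I (t j) & s_theta (s j.+1) = theta' j] /\
  [/\ step1 N h D (s_N (s j.+1)) (s_Nt (s j.+1)) & s_Delta (s j) <= s_Delta (s j.+1)].
Proof.
move=> aj; have [_ _ _] := hrun.2 j; rewrite /update aj.
by move=> [[? _ ? ? ?] [? /andP[? _]]].
Qed.

Lemma update_rejected j : ~~ acpt j ->
  s j.+1 = State (s_k (s j)) (s_T (s j)).+1 (s_x (s j)) (s_I (s j)) (s_theta (s j))
    (s_Nt (s j)) (d_zeta1 D * s_Delta (s j)).
Proof. by move=> aj; have [_ _ _] := hrun.2 j; rewrite /update (negbTE aj). Qed.

Lemma step1_run j : step1 N h D (s_N (s j)) (s_Nt (s j)).
Proof.
elim: j => [|j IH]; first by have [[_ []]] := hrun.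
have [aj|aj] := boolP (acpt j); first by have [_ []] := update_accepted j aj.
by rewrite update_rejected.
Qed.

Lemma Delta_gt0 j : 0 < s_Delta (s j).
Proof.
elim: j => [|j IH].
  by have [[_ [-> _]] _] := hrun; case: hD => -[].
have [aj|aj] := boolP (acpt j).
  by have [_ [_]] := update_accepted j aj; exact: lt_le_trans.
by rewrite update_rejected//= mulr_gt0//; have /andP[] := zeta1_bounds.
Qed.

Let gapmin := (1 - d_r D) * hmin.

Lemma gapmin_gt0 : 0 < gapmin.
Proof. by rewrite mulr_gt0 ?hmin_gt0//; have := r_bounds; lra. Qed.

(** Step 1 gives [h(Ntilde_{k+1}) <= r h(N_k)], hence a gap of at least [(1 - r) h(N_k)]. *)
Lemma hgap_ge j : (s_N (s j) < N)%N -> gapmin <= hgap j.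
Proof.
move=> lt; have := step1_run j; rewrite /step1 lt => -[_].
have := h_ge_hmin _ lt; have /andP[_ r1] := r_bounds; rewrite /gapmin => H1 H2.
have : (1 - d_r D) * hmin <= (1 - d_r D) * h (s_N (s j)).
  by rewrite ler_wpM2l// subr_ge0 ltW.
lra.
Qed.

Lemma sNt_full j : s_N (s j) = N -> s_Nt (s j) = N.
Proof. by move=> e; have := step1_run j; rewrite /step1 e ltnn. Qed.

Lemma hgap_full j : s_N (s j) = N -> hgap j = 0.
Proof. by move=> e; rewrite sNt_full// e subrr. Qed.

Lemma sN_cases j : (s_N (s j) < N)%N \/ s_N (s j) = N.
Proof.
by have := card_le_N (s_I (s j)); rewrite leq_eqVlt => /predU1P[|]; [right|left].
Qed.

Lemma hgap_ge0 j : 0 <= hgap j.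
Proof.
by have [/hgap_ge|/hgap_full->//] := sN_cases j; apply: le_trans; rewrite ltW ?gapmin_gt0.
Qed.

Lemma ffull_sample (I : {set 'I_N}) : #|I| = N -> favg phi I = ffull phi.
Proof. by move=> /sample_full ->. Qed.

Lemma model_error j :
  `|modelf j (t_p (t j)) - favg phi (t_I (t j)) (s_x (s j) + t_p (t j))|
  <= C * s_Delta (s j) ^+ 2.
Proof.
have [_ _ [_ _ pD _] _] := hrun.2 j.
have lip := lipschitz_grad_favg dphi (t_I (t j)) L _ L_ge0 (hL ^~ j).
have := taylor_bound _ _ _ _ (differentiable_favg dphi (t_I (t j))) L_ge0 lip.
have := quad_form_le _ (t_p (t j)) _ (hB j).
rewrite /mk /model; set p := t_p (t j) in pD *.
have : C * enorm p ^+ 2 <= C * s_Delta (s j) ^+ 2.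
  by rewrite ler_wpM2l ?(ltW C_gt0)// lerXn2r ?nnegrE ?enorm_ge0// ltW ?Delta_gt0.
rewrite /C !ler_norml; set P := enorm p ^+ 2; set Q := dot p _.
move=> H1 /andP[? ?] /andP[? ?]; apply/andP; split; lra.
Qed.

Lemma cauchy_gain j : 2^-1 * enorm (grad (favg phi (t_I (t j))) (s_x (s j))) *
   Num.min (s_Delta (s j)) (enorm (grad (favg phi (t_I (t j))) (s_x (s j))) / kappa)
  <= modelf j 0 - modelf j (t_pC (t j)).
Proof.
have [_ _ [_ pC _ _] _] := hrun.2 j.
exact: cauchy_step_decrease (Delta_gt0 j) kappa_gt0 (hB j) pC.
Qed.

Lemma cauchy_gain_ge0 j : 0 <= modelf j 0 - modelf j (t_pC (t j)).
Proof.
apply: le_trans (cauchy_gain j); rewrite !mulr_ge0 ?enorm_ge0// ?invr_ge0//.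
by rewrite le_min ltW ?Delta_gt0//= divr_ge0 ?enorm_ge0// ltW.
Qed.

Lemma model_decrease j :
  tau * (modelf j 0 - modelf j (t_pC (t j))) <= modelf j 0 - modelf j (t_p (t j)).
Proof. by have [_ _ [_ _ _]] := hrun.2 j. Qed.

Lemma model_decrease_ge0 j : 0 <= modelf j 0 - modelf j (t_p (t j)).
Proof.
apply: le_trans (model_decrease j); rewrite mulr_ge0 ?cauchy_gain_ge0//.
by have /andP[/ltW] := tau_bounds.
Qed.

Lemma model_at0 j : modelf j 0 = favg phi (t_I (t j)) (s_x (s j)).
Proof. exact: model0. Qed.

(** If the trial sample is full, [m_k(0) = f_N(x_k)] and this is the model decrease; if not, passing
    the test of Step 3 bounds the difference below by a multiple of the Cauchy gain. *)
Lemma full_pred_ge0 j : s_N (s j) = N -> ~~ step3_rejects phi D (s j) (t j) ->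
  0 <= fk j - modelf j (t_p (t j)).
Proof.
move=> sN; rewrite /step3_rejects sN eqxx /= (ffull_sample _ sN).
have := card_le_N (t_I (t j)); rewrite -/(t_N (t j)) leq_eqVlt => /predU1P[tN _|->].
  by rewrite -(ffull_sample _ tN) -model_at0 model_decrease_ge0.
rewrite /= -leNgt; apply: le_trans; rewrite mulr_ge0 ?cauchy_gain_ge0//.
by have /andP[/ltW] := tau_bounds.
Qed.

(** * The penalty parameters stay away from 0 *)

Let theta_floor := (1 - eta) * gapmin / (2 * F + h 0%N).

Lemma theta_floor_gt0 : 0 < theta_floor.
Proof.
have /andP[_ eta1] := eta_bounds; have h0 := h0_gt0.
apply: divr_gt0; first by rewrite mulr_gt0 ?gapmin_gt0// subr_gt0.
by have := F_ge0; lra.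
Qed.

(** With gap [g], [Pred(a) = g - a (m - f + g)] is affine in [a], and the new parameter solves
    [Pred(a) = eta g]. Its numerator is at least [(1 - eta) gapmin] and its denominator at most
    [2 F + h 0], whence [theta_floor]. With a full sample [g = 0] and [Pred >= 0], so the test of
    Step 4 cannot fail. *)
Lemma step4_theta_spec j : 0 < s_theta (s j) < 1 ->
  ~~ step3_rejects phi D (s j) (t j) ->
  [/\ 0 < theta' j <= s_theta (s j),
      eta * hgap j <= pred_red phi h (s j) (t j) (theta' j),
      theta' j = s_theta (s j) \/ theta_floor <= theta' j
    & s_N (s j) = N -> theta' j = s_theta (s j)].
Proof.
move=> /andP[th0 th1] rej; have /andP[eta0 eta1] := eta_bounds.
rewrite /step4_theta; case: ifPn => [ok|]; first by split; [rewrite th0 lexx| |left|].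
rewrite -ltNge => bad.
have sN : (s_N (s j) < N)%N.
  have [//|e] := sN_cases j; move: bad; rewrite /pred_red (hgap_full _ e) !mulr0 addr0.
  by rewrite ltNge mulr_ge0 ?(ltW th0) ?full_pred_ge0.
have gap_ge := hgap_ge j sN.
have gap0 := lt_le_trans gapmin_gt0 gap_ge.
have gapE : modelf j (t_p (t j)) - fk j + h (s_N (s j)) - h (s_Nt (s j)) =
  modelf j (t_p (t j)) - fk j + hgap j by rewrite addrA.
have gap_le : hgap j <= h 0%N.
  have : 0 <= h (s_Nt (s j)).
    rewrite -h_N; apply: h_mono.
    by have := step1_run j; rewrite /step1 sN => -[/andP[]].
  by have := h_mono 0%N (s_N (s j)) isT; lra.
have mf : modelf j (t_p (t j)) - fk j <= 2 * F.
  have := model_decrease_ge0 j; rewrite model_at0.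
  have := hF (t_I (t j)) j; have := hF (s_I (s j)) j; rewrite !ler_norml.
  by move=> /andP[? ?] /andP[? ?]; lra.
rewrite /pred_red gapE; move: bad; rewrite /pred_red.
move: (modelf j (t_p (t j))) (fk j) (hgap j) gap_ge gap0 gap_le mf.
move=> m f g gmin g0 gle mf bad.
set th := s_theta (s j) in th0 th1 bad *.
(* The failed test, rearranged: it makes the denominator [m - f + g] positive and puts the new
   parameter below [th]. *)
have thd : (1 - eta) * g < th * (m - f + g) by lra.
have d0 : 0 < m - f + g.
  by rewrite -(pmulr_rgt0 _ th0); apply: lt_trans thd; rewrite mulr_gt0// subr_gt0.
have num0 : 0 < (1 - eta) * g by rewrite mulr_gt0// subr_gt0.
split.
- by rewrite divr_gt0//= ler_pdivrMr// ltW.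
- have e (a : R) : a * (f - m) + (1 - a) * g = g - a * (m - f + g) by ring.
  by rewrite e divfK ?gt_eqF//; lra.
- right; rewrite /theta_floor; apply: ler_pM.
  + by rewrite ltW// mulr_gt0 ?gapmin_gt0// subr_gt0.
  + by rewrite invr_ge0; lra.
  + by rewrite ler_wpM2l// subr_ge0 ltW.
  + by rewrite lef_pV2 ?posrE//; lra.
- by move=> e; rewrite e ltnn in sN.
Qed.

Lemma accepted_not_rejected j : acpt j -> ~~ step3_rejects phi D (s j) (t j).
Proof. by case/andP. Qed.

Lemma theta_bounds j : 0 < s_theta (s j) < 1.
Proof.
elim: j => [|j IH].
  by have [[[_ _ _ _ ->] _] _] := hrun; case: hD => -[].
have [aj|aj] := boolP (acpt j); last by rewrite update_rejected.
have [[_ _ _ ->] _] := update_accepted j aj.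
have [/andP[-> le] _ _ _] := step4_theta_spec j IH (accepted_not_rejected j aj).
by have /andP[_] := IH; exact: le_lt_trans.
Qed.

Lemma theta_ge j : Num.min (d_theta0 D) theta_floor <= s_theta (s j).
Proof.
elim: j => [|j IH].
  by have [[[_ _ _ _ ->] _] _] := hrun; rewrite ge_min lexx.
have [aj|aj] := boolP (acpt j); last by rewrite update_rejected.
have [[_ _ _ ->] _] := update_accepted j aj.
have [_ _ [->//|le] _] :=
  step4_theta_spec j (theta_bounds j) (accepted_not_rejected j aj).
by rewrite ge_min le orbT.
Qed.

(** * Steps with a small radius are accepted *)

Lemma infeasibility_slack j : s_Delta (s j) <= 1 ->
  h (t_N (t j)) - h (s_Nt (s j)) <= s_Delta (s j).
Proof.
move=> D1; have [[_ slack] _ _ _] := hrun.2 j.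
have D0 := Delta_gt0 j.
case: hD => -[_ _ _ _ /andP[g0 _]] [_ _ _ /andP[mu0 mu1] _].
apply: le_trans slack _.
(* One factor [Delta] is split off; what remains, [mu Delta^gamma], is at most 1. *)
rewrite powRD; last by rewrite gt_eqF ?implybT// (lt_trans ltr01)// ltrDl.
rewrite powRr1 ?(ltW D0)// mulrCA ler_piMr ?(ltW D0)// mulr_ile1 ?powR_ge0 ?(ltW mu1)//.
have <- : 1 `^ d_gamma D = 1 by rewrite powR1.
by rewrite ge0_ler_powR ?nnegrE ?(ltW g0) ?(ltW D0) ?ler01.
Qed.

(** An incomplete trial sample would have infeasibility at least [hmin], while the slack allows at
    most [Delta <= hmin / 2]. *)
Lemma small_radius_full_sample j : s_N (s j) = N -> s_Delta (s j) <= 1 ->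
  s_Delta (s j) <= hmin / 2 -> t_N (t j) = N.
Proof.
move=> sN D1 Dh; have := card_le_N (t_I (t j)); rewrite -/(t_N (t j)).
rewrite leq_eqVlt => /predU1P[//|/h_ge_hmin hge]; exfalso.
have := infeasibility_slack j D1; rewrite (sNt_full j sN) h_N subr0 => hle.
by have := hmin_gt0; have := le_trans hge hle; lra.
Qed.

(** [Pred] is at least [eta gapmin], whereas for [Delta <= 1] the loss from [Pred] to [Ared] is at
    most [(C + 1) Delta]: [C Delta] from the model error and [Delta] from the infeasibility
    slack. *)
Lemma accepted_subsampled : exists2 delta : R, 0 < delta &
  forall j, (s_N (s j) < N)%N -> s_Delta (s j) <= delta -> acpt j.
Proof.
have /andP[eta0 eta1] := eta_bounds.
have C0 := C_gt0.
pose b := (1 - eta) * (eta * gapmin).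
have b0 : 0 < b by rewrite mulr_gt0 ?subr_gt0// mulr_gt0 ?gapmin_gt0.
have C1 : 0 < C + 1 := addr_gt0 C0 ltr01.
exists (Num.min 1 (b / (C + 1))).
  by rewrite lt_min ltr01 divr_gt0.
move=> j sN; rewrite le_min => /andP[D1].
rewrite ler_pdivlMr// => Db.
have D0 := Delta_gt0 j.
have rej : ~~ step3_rejects phi D (s j) (t j) by rewrite /step3_rejects ltn_eqF.
have [/andP[th0 thle] pr _ _] := step4_theta_spec j (theta_bounds j) rej.
have /andP[_ th1] := theta_bounds j.
have {}th1 := le_lt_trans thle th1.
rewrite /accepted rej /=.
have := infeasibility_slack j D1; have := model_error j.
have : C * s_Delta (s j) ^+ 2 <= C * s_Delta (s j).
  by rewrite ler_wpM2l ?(ltW C0)// expr2 ler_piMr// ltW.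
have : b <= (1 - eta) * pred_red phi h (s j) (t j) (theta' j).
  rewrite ler_wpM2l ?subr_ge0 ?(ltW eta1)//; apply: le_trans pr.
  by rewrite ler_wpM2l ?(ltW eta0)// hgap_ge.
have -> : ared phi h (s j) (t j) (theta' j) = pred_red phi h (s j) (t j) (theta' j) +
   (theta' j * (modelf j (t_p (t j)) - favg phi (t_I (t j)) (s_x (s j) + t_p (t j)))
   - (1 - theta' j) * (h (t_N (t j)) - h (s_Nt (s j)))).
  by rewrite /ared /pred_red; ring.
set e := _ - favg _ _ _; set y := h _ - h _; set P := pred_red _ _ _ _ _.
move: (theta' j) th0 th1 => a a0 a1 bP CD; rewrite ler_norml => /andP[le _] yD.
have : a * e >= - (C * s_Delta (s j)).
  apply: le_trans (_ : a * - (C * s_Delta (s j)) <= _).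
    by rewrite mulrN lerN2 ler_piMl ?(ltW a1)// mulr_ge0 ?ltW.
  by rewrite ler_wpM2l ?(ltW a0)//; lra.
have : (1 - a) * y <= s_Delta (s j).
  apply: le_trans (_ : (1 - a) * s_Delta (s j) <= _).
    by rewrite ler_wpM2l// subr_ge0 ltW.
  by rewrite ler_piMl ?(ltW D0)//; lra.
lra.
Qed.

(** The classical trust-region argument: the predicted decrease is of order [e Delta], the model
    error of order [Delta^2], and the positive factor [theta] cancels. *)
Lemma accepted_full (e : R) : 0 < e -> exists2 delta : R, 0 < delta &
  forall j, s_N (s j) = N -> e <= gradN j -> s_Delta (s j) <= delta -> acpt j.
Proof.
move=> e0; have /andP[eta0 eta1] := eta_bounds.
have /andP[tau0 tau1] := tau_bounds.
have C0 := C_gt0; have hm0 := hmin_gt0.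
pose b := (1 - eta) * (tau * (2^-1 * e)).
have b0 : 0 < b by rewrite mulr_gt0 ?subr_gt0// mulr_gt0// mulr_gt0.
(* The bounds [1] and [hmin / 2] force a full trial sample, [b / C] beats the model error, and
   [e / kappa] makes the minimum in the Cauchy gain equal to [Delta]. *)
exists (Num.min (Num.min 1 (hmin / 2)) (Num.min (b / C) (e / kappa))).
  by rewrite !lt_min ltr01 !divr_gt0.
move=> j sN eg; rewrite !le_min => /andP[/andP[D1 Dh] /andP[]].
rewrite !ler_pdivlMr// => Db Dk.
have D0 := Delta_gt0 j.
have tN := small_radius_full_sample j sN D1 Dh.
have Nt := sNt_full j sN.
have rej : ~~ step3_rejects phi D (s j) (t j) by rewrite /step3_rejects tN ltnn !andbF.
have [_ _ _ th] := step4_theta_spec j (theta_bounds j) rej.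
rewrite /accepted rej/= (th sN) /pred_red /ared sN Nt tN subrr !mulr0 !addr0.
rewrite (ffull_sample _ sN) (ffull_sample _ tN).
have /andP[th0 _] := theta_bounds j.
rewrite mulrCA ler_pM2l//.
have m0 : ffull phi (s_x (s j)) = modelf j 0 by rewrite model_at0 (ffull_sample _ tN).
have : C * s_Delta (s j) ^+ 2 <= b * s_Delta (s j).
  by rewrite expr2 mulrA ler_wpM2r ?(ltW D0)// mulrC.
have : b * s_Delta (s j) <= (1 - eta) * (modelf j 0 - modelf j (t_p (t j))).
  rewrite /b -mulrA ler_wpM2l ?subr_ge0 ?(ltW eta1)//.
  apply: le_trans (model_decrease j); rewrite -mulrA ler_wpM2l ?(ltW tau0)//.
  apply: le_trans (cauchy_gain j); rewrite (ffull_sample _ tN).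
  apply: ler_pM; rewrite ?(ltW D0)//; first by rewrite mulr_ge0 ?(ltW e0)// invr_ge0.
    by rewrite ler_wpM2l// invr_ge0.
  by rewrite le_min lexx/= ler_pdivlMr// (le_trans Dk).
have := model_error j; rewrite (ffull_sample _ tN) ler_norml => /andP[+ _].
rewrite m0; lra.
Qed.

(** * Every iteration ends after finitely many rejections *)

Definition core (st : state R N n) := (s_k st, s_x st, s_I st, s_theta st, s_Nt st).

Lemma core_rejected j : ~~ acpt j -> core (s j.+1) = core (s j).
Proof. by move=> /update_rejected ->. Qed.

Lemma rejected_run j : (forall i, ~~ acpt (j + i)) -> forall i,
  core (s (j + i)) = core (s j) /\ s_Delta (s (j + i)) = d_zeta1 D ^+ i * s_Delta (s j).
Proof.
move=> rej; elim=> [|i [IHc IHD]]; first by rewrite addn0 expr0 mul1r.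
rewrite addnS core_rejected//; split=> //.
by rewrite update_rejected//= IHD exprS mulrA.
Qed.

(** A rejection changes only the counter [s_T] and the radius, so one threshold is needed for all
    passes sharing the [core] of pass [j]. It may depend on the gradient at the current iterate. *)
Lemma accepted_small_radius j : exists2 delta : R, 0 < delta &
  forall i, core (s i) = core (s j) -> s_Delta (s i) <= delta -> acpt i.
Proof.
have [sN|sN] := sN_cases j.
  have [delta d0 H] := accepted_subsampled; exists delta => // i [_ _ eI _ _] Di.
  by apply: H => //; rewrite /s_N eI.
have [/eqP g0|g0] := boolP (gradN j == 0); last first.
  have g1 : 0 < gradN j by rewrite lt_neqAle eq_sym g0 enorm_ge0.
  have [delta d0 H] := accepted_full _ g1; exists delta => // i [_ eX eI _ _] Di.
  by apply: H => //; rewrite ?eX// /s_N eI.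
(* At a stationary point of the full average every admissible small radius
   would force the full sample, and the run would have stopped. *)
have hm0 := hmin_gt0.
exists (Num.min 1 (hmin / 2)); first by rewrite lt_min ltr01 divr_gt0.
move=> i [_ eX eI _ _]; rewrite le_min => /andP[D1 Dh].
have siN : s_N (s i) = N by rewrite /s_N eI.
have tN := small_radius_full_sample i siN D1 Dh.
have [_ + _ _] := hrun.2 i.
by rewrite /stops siN eqxx (ffull_sample _ tN) eX g0 heps lexx.
Qed.

(** Rejections without end would shrink the radius geometrically below the threshold of
    [accepted_small_radius]. *)
Lemma next_accepted j : exists2 i, acpt i & core (s i) = core (s j).
Proof.
have [delta d0 small] := accepted_small_radius j.
have ex : exists i, acpt (j + i).
  apply: contrapT => /forallNP rej.
  have {}rej i : ~~ acpt (j + i) by apply/negP; exact: rej.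
  have /andP[z0 z1] := zeta1_bounds.
  have : (fun i => d_zeta1 D ^+ i * s_Delta (s j)) @ \oo --> 0 * s_Delta (s j).
    by apply: cvgMl; apply: cvg_expr; rewrite ger0_norm// ltW.
  rewrite mul0r => /cvgrPdist_lt/(_ _ d0)[m _ /(_ m (leqnn m))].
  rewrite /= sub0r normrN ger0_norm ?mulr_ge0 ?exprn_ge0 ?(ltW z0) ?(ltW (Delta_gt0 j))//.
  have [ec <-] := rejected_run j rej m => Dm.
  by have := rej m; rewrite small// ltW.
(* Taking the first accepted pass leaves only rejections before it, and these preserve [core]. *)
case: (ex_minnP ex) => i ai min_i; exists (j + i)%N => //.
elim: i {ai} min_i => [|i IH] min_i; first by rewrite addn0.
rewrite addnS core_rejected; first by apply: IH => k /min_i/ltnW.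
by apply/negP => /min_i; rewrite ltnn.
Qed.

Lemma sk_mono i j : (i <= j)%N -> (s_k (s i) <= s_k (s j))%N.
Proof.
apply: (@homo_leq _ (fun j => s_k (s j)) leq) => //; first exact: leq_trans.
move=> {}j; have [aj|aj] := boolP (acpt j); last by rewrite update_rejected.
by have [[-> _ _ _] _] := update_accepted j aj.
Qed.

Lemma sk_lt i j : acpt i -> (i < j)%N -> (s_k (s i) < s_k (s j))%N.
Proof. by move=> ai /sk_mono; have [[-> _ _ _] _] := update_accepted i ai. Qed.

(** The iteration counter never decreases and grows strictly past an accepted pass. *)
Lemma ends_iteration_inj k i j :
  ends_iteration phi h D s t k i -> ends_iteration phi h D s t k j -> i = j.
Proof.
move=> [ki ai] [kj aj]; have [ij|ji|//] := ltngtP i j.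
  by have := sk_lt i j ai ij; rewrite ki kj ltnn.
by have := sk_lt j i aj ji; rewrite ki kj ltnn.
Qed.

Lemma ends_iteration_ex k : exists j, ends_iteration phi h D s t k j.
Proof.
elim: k => [|k [j [kj aj]]].
  have [j aj [k0 _ _ _ _]] := next_accepted 0.
  by exists j; split => //; rewrite k0; have [[[->]]] := hrun.
have [[kj' _ _ _] _] := update_accepted j aj.
have [i ai [ki _ _ _ _]] := next_accepted j.+1.
by exists i; split => //; rewrite ki kj' kj.
Qed.

(** * The accepted passes and the merit function *)

Section Accepted.
Context {acc : nat -> nat}.
Hypothesis acc_ends : forall k, ends_iteration phi h D s t k (acc k).

(** The next accepted pass shares the [core] of [j], so it ends the same iteration; by uniqueness it
    is the one listed in [acc]. *)
Lemma core_acc j : core (s j) = core (s (acc (s_k (s j)))).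
Proof.
have [i ai ci] := next_accepted j.
have ei : ends_iteration phi h D s t (s_k (s j)) i.
  by split => //; move: ci => [].
by rewrite -ci (ends_iteration_inj _ _ _ (acc_ends _) ei).
Qed.

Lemma core_acc_next k : core (s (acc k.+1)) = core (s (acc k).+1).
Proof.
have [kj aj] := acc_ends k; have [[kj' _ _ _] _] := update_accepted _ aj.
by rewrite [RHS]core_acc kj' kj.
Qed.

Let X k := s_x (s (acc k)).

Lemma acc_next k :
  [/\ X k.+1 = X k + t_p (t (acc k)), s_I (s (acc k.+1)) = t_I (t (acc k))
    & s_theta (s (acc k.+1)) = theta' (acc k)].
Proof.
have [_ aj] := acc_ends k; have [[_ <- <- <-] _] := update_accepted _ aj.
by have [_ ? ? ? _] := core_acc_next k.
Qed.

(* Dividing the merit function by theta makes its weight on h nondecreasing, and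
   shifting h by [h 0] turns that drift into a further decrease. *)
Let merit k := fk (acc k) +
  ((s_theta (s (acc k)))^-1 - 1) * (h (s_N (s (acc k))) - h 0%N).

(** One factor [eta] comes from the acceptance test of Step 5, the other from Step 4; dividing by
    [theta <= 1] preserves the bound. *)
Lemma merit_decrease k : merit k.+1 <= merit k - eta ^+ 2 * hgap (acc k).
Proof.
have [eX eI eth] := acc_next k; have [_ aj] := acc_ends k.
set j := acc k in eX eI eth aj *.
have [/andP[th0 thle] pr _ _] :=
  step4_theta_spec j (theta_bounds j) (accepted_not_rejected j aj).
have /andP[eta0 eta1] := eta_bounds; have /andP[t0 _] := theta_bounds j.
have /andP[_ acc_ge] := aj.
have ared_ge : eta ^+ 2 * hgap j <= ared phi h (s j) (t j) (theta' j).
  by apply: le_trans acc_ge; rewrite expr2 -mulrA ler_wpM2l ?(ltW eta0).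
rewrite /merit -/j eI -/(X k.+1) eX eth /X -/j.
have -> : s_N (s (acc k.+1)) = t_N (t j) by rewrite /s_N eI.
have hN0 := h_mono 0%N (s_N (s j)) isT.
have : eta ^+ 2 * hgap j <= (theta' j)^-1 * ared phi h (s j) (t j) (theta' j).
  apply: le_trans (ared_ge) _; rewrite ler_peMl//.
    by apply: le_trans ared_ge; rewrite mulr_ge0 ?sqr_ge0 ?hgap_ge0.
  rewrite invf_ge1//; apply: le_trans thle _.
  by have /andP[_ /ltW] := theta_bounds j.
have -> : (theta' j)^-1 * ared phi h (s j) (t j) (theta' j) =
  fk j - favg phi (t_I (t j)) (s_x (s j) + t_p (t j)) +
  ((theta' j)^-1 - 1) * (h (s_N (s j)) - h (t_N (t j))).
  by rewrite /ared; field; rewrite gt_eqF.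
(* The drift of the weight: [theta] does not increase and [h(N_k) <= h(0)]. *)
have : ((theta' j)^-1 - (s_theta (s j))^-1) * (h (s_N (s j)) - h 0%N) <= 0.
  by rewrite mulr_ge0_le0 ?subr_le0// subr_ge0 lef_pV2.
lra.
Qed.

(** The average is at least [-F]; as [h(N_k) >= 0], the other term is at least
    [-(1/theta - 1) h(0)], which the lower bound on [theta] controls. *)
Lemma merit_ge k :
  - F - (Num.min (d_theta0 D) theta_floor)^-1 * h 0%N <= merit k.
Proof.
rewrite /merit; set j := acc k.
have := hF (s_I (s j)) j; rewrite ler_norml => /andP[+ _].
have /andP[t0 t1] := theta_bounds j.
have m0 : 0 < Num.min (d_theta0 D) theta_floor.
  rewrite lt_min theta_floor_gt0 andbT.
  by have [[_ /andP[]]] := hD.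
have hN : 0 <= h (s_N (s j)) by rewrite -h_N; apply: h_mono; exact: card_le_N.
have : (s_theta (s j))^-1 <= (Num.min (d_theta0 D) theta_floor)^-1.
  by rewrite lef_pV2// theta_ge.
have : 1 <= (s_theta (s j))^-1 by rewrite invf_ge1// ltW.
have h00 := h0_gt0.
set a := (s_theta _)^-1; set b := (Num.min _ _)^-1; set y := h (s_N _) in hN *.
move=> a1 ab.
have : 0 <= (a - 1) * y by rewrite mulr_ge0// subr_ge0.
have : (a - 1) * h 0%N <= b * h 0%N by rewrite ler_wpM2r ?(ltW h00)//; lra.
lra.
Qed.

Lemma eventually_full : exists K, forall k, (K <= k)%N -> s_N (s (acc k)) = N.
Proof.
have /andP[eta0 _] := eta_bounds.
have [|||K HK] := bounded_drops merit _ (eta ^+ 2 * gapmin)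
    (fun k => (s_N (s (acc k)) < N)%N) merit_ge.
- move=> k; apply: le_trans (merit_decrease k) _.
  by rewrite gerBl mulr_ge0 ?sqr_ge0 ?hgap_ge0.
- by rewrite mulr_gt0 ?gapmin_gt0// exprn_gt0.
- move=> k sN; apply: le_trans (merit_decrease k) _.
  by rewrite lerB// ler_wpM2l ?sqr_ge0 ?hgap_ge.
by exists K => k /HK; case: (sN_cases (acc k)).
Qed.

(** * The trust-region phase on the full average *)

Section Full.
Context {K0 : nat}.
Hypothesis full : forall k, (K0 <= k)%N -> s_N (s (acc k)) = N.

(** The sample accepted at iteration [k] is the current sample of iteration [k + 1], which is
    full. *)
Lemma trial_full k : (K0 <= k)%N -> t_N (t (acc k)) = N.
Proof.
by move=> Kk; have [_ eI _] := acc_next k; rewrite /t_N -eI; exact: full (leqW Kk).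
Qed.

(** With both samples full the infeasibility terms vanish, and [theta] is a common positive factor
    of [Ared] and [Pred]. *)
Lemma trust_region_step_full k : (K0 <= k)%N ->
  trust_region_step (ffull phi) eta tau (X k) (s_Delta (s (acc k)))
    (t_B (t (acc k))) (t_pC (t (acc k))) (t_p (t (acc k))) (X k.+1).
Proof.
move=> Kk; have tN := trial_full k Kk; have sN := full k Kk.
have [eX _ _] := acc_next k; have [_ aj] := acc_ends k.
set j := acc k in tN sN eX aj *.
have [_ _ [Bs pC pD cd] _] := hrun.2 j.
rewrite (ffull_sample _ tN) in pC cd.
split => //.
have [_ _ _ th] := step4_theta_spec j (theta_bounds j) (accepted_not_rejected j aj).
have /andP[_] := aj; rewrite /accepted (th sN) /pred_red /ared sN tN.
rewrite (sNt_full _ sN) subrr !mulr0 !addr0 /mk.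
rewrite (ffull_sample _ sN) (ffull_sample _ tN) model0.
by have /andP[th0 _] := theta_bounds j; rewrite mulrCA ler_pM2l.
Qed.

Lemma full_decrease k : (K0 <= k)%N ->
  eta * (tau * 2^-1) * (gradN (acc k) *
    Num.min (s_Delta (s (acc k))) (gradN (acc k) / kappa))
  <= ffull phi (X k) - ffull phi (X k.+1).
Proof.
move=> Kk; have [_ _ _ + ->] := trust_region_step_full k Kk.
apply: le_trans; rewrite -mulrA ler_wpM2l//.
  by have /andP[/ltW] := eta_bounds.
have := model_decrease (acc k); rewrite /mk (ffull_sample _ (trial_full k Kk)).
apply: le_trans; rewrite -mulrA ler_wpM2l//.
  by have /andP[/ltW] := tau_bounds.
have := cauchy_gain (acc k); rewrite /mk (ffull_sample _ (trial_full k Kk)).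
by rewrite mulrA.
Qed.

Lemma min_radius_ge0 k : 0 <= Num.min (s_Delta (s (acc k))) (gradN (acc k) / kappa).
Proof. by rewrite le_min (ltW (Delta_gt0 _))/= divr_ge0 ?enorm_ge0 ?(ltW kappa_gt0). Qed.

Let c1 := eta * (tau * 2^-1).

Lemma c1_gt0 : 0 < c1.
Proof.
have /andP[e0 _] := eta_bounds; have /andP[t0 _] := tau_bounds.
by rewrite mulr_gt0// mulr_gt0// invr_gt0.
Qed.

Lemma ffull_tail (e : R) : 0 < e -> exists K, forall k l, (K <= k)%N -> (k <= l)%N ->
  ffull phi (X k) - ffull phi (X l) < e.
Proof.
apply: (nonincreasing_tail (fun k => ffull phi (X k)) (- F) K0) => k.
  by have := hF [set: 'I_N]%SET (acc k); rewrite ler_norml => /andP[].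
move=> Kk; rewrite -subr_ge0; apply: le_trans (full_decrease k Kk).
rewrite mulr_ge0 ?(ltW c1_gt0)// mulr_ge0 ?enorm_ge0//.
exact: min_radius_ge0.
Qed.

(** Acceptance never shrinks the radius, and a rejection occurs only above [delta], so it leaves
    more than [zeta1 delta]. *)
Lemma radius_bounded_below (e : R) K : 0 < e -> (K0 <= K)%N ->
  (forall k, (K <= k)%N -> e <= gradN (acc k)) ->
  exists2 d : R, 0 < d & forall k, (K <= k)%N -> d <= s_Delta (s (acc k)).
Proof.
move=> e0 KK big; have [delta d0 small] := accepted_full e e0.
have /andP[z0 z1] := zeta1_bounds.
exists (Num.min (s_Delta (s (acc K))) (d_zeta1 D * delta)).
  by rewrite lt_min Delta_gt0/= mulr_gt0.
(* The induction runs over all passes after [acc K], since the rejected ones are those that shrink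
   the radius. *)
have H i : Num.min (s_Delta (s (acc K))) (d_zeta1 D * delta) <= s_Delta (s (acc K + i)).
  elim: i => [|i IH]; first by rewrite addn0 ge_min lexx.
  rewrite addnS; set j := (acc K + i)%N in IH *.
  have [aj|aj] := boolP (acpt j).
    by have [_ [_]] := update_accepted _ aj; exact: le_trans.
  have kj : (K <= s_k (s j))%N.
    have [kK _] := acc_ends K.
    by have := sk_mono (acc K) j (leq_addr _ _); rewrite kK.
  rewrite (update_rejected _ aj)/= ge_min ler_pM2l//; apply/orP; right.
  rewrite leNgt; apply: contra aj => Dj; apply: small; last exact: ltW.
    have [_ _ eI _ _] := core_acc j.
    by rewrite /s_N eI; apply: full; exact: leq_trans kj.
  by have [_ -> _ _ _] := core_acc j; exact: big.
move=> k Kk; have aKk : (acc K <= acc k)%N.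
  rewrite leqNgt; apply/negP => lt.
  have [kk ak] := acc_ends k; have [kK _] := acc_ends K.
  by have := sk_lt _ _ ak lt; rewrite kk kK ltnNge Kk.
by rewrite -(subnKC aKk).
Qed.

(** Otherwise gradients and radii stay bounded below, and each iteration lowers [f_N] by a fixed
    [c], against [ffull_tail]. *)
Lemma gradient_small (e : R) K : 0 < e -> exists2 k, (K <= k)%N & gradN (acc k) < e.
Proof.
move=> e0; apply: contrapT => nex.
have big k : (maxn K K0 <= k)%N -> e <= gradN (acc k).
  rewrite geq_max => /andP[Kk _]; rewrite leNgt; apply/negP => lt.
  by apply: nex; exists k.
have [d d0 Dd] := radius_bounded_below e _ e0 (leq_maxr _ _) big.
pose c := c1 * (e * Num.min d (e / kappa)).
have c0 : 0 < c by rewrite mulr_gt0 ?c1_gt0// mulr_gt0// lt_min d0 divr_gt0.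
have [K1 HK1] := ffull_tail c c0.
pose k := maxn K1 (maxn K K0).
have := HK1 k k.+1 (leq_maxl _ _) (leqnSn _); rewrite ltNge => /negP; apply.
have Kk : (maxn K K0 <= k)%N := leq_maxr _ _.
apply: le_trans (full_decrease k (leq_trans (leq_maxr _ _) Kk)).
have gk := big k Kk.
rewrite ler_wpM2l ?(ltW c1_gt0)//; apply: ler_pM => //; first exact: ltW.
  by rewrite le_min !ltW ?divr_gt0.
rewrite le_min !ge_min (Dd k Kk)/=; apply/orP; right.
by rewrite ler_pM2r ?invr_gt0.
Qed.

Lemma gradient_step k : gradN (acc k) - gradN (acc k.+1) <= L * s_Delta (s (acc k)).
Proof.
have [eX _ _] := acc_next k; rewrite -/(X k.+1) eX /X.
have [_ _ [_ _ pD _] _] := hrun.2 (acc k).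
have lip := lipschitz_grad_favg dphi [set: 'I_N]%SET L _ L_ge0 (hL ^~ (acc k)).
apply: le_trans (ler_dist_enorm _ _) _.
set x := s_x _ in lip *; set p := t_p _ in pD lip *.
apply: le_trans (lip _ _ _ _) _.
- by exists 0; rewrite /= ?lexx ?ler01// scale0r addr0.
- by exists 1; rewrite /= ?lexx ?ler01// scale1r addrC subrK.
by rewrite ler_wpM2l// opprD addNKr enormN.
Qed.

Lemma gradient_cvg : (fun k => gradN (acc k)) @ \oo --> (0 : R).
Proof.
apply/cvgrPdist_lt => e e0.
have [e2 hk] : 0 < e / 2 /\ 0 < e / 2 / kappa by rewrite !divr_gt0.
pose b := c1 * (e / 2).
have b0 : 0 < b by rewrite mulr_gt0 ?c1_gt0.
have L1 : 0 < L + 1 by rewrite ltr_wpDl.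
(* The first bound excludes a decrease governed by [|g| / kappa]; the second limits the total
   gradient drop to [e / 2]. Using [L + 1] keeps the divisor positive when [L = 0]. *)
pose d := Num.min (b * (e / 2 / kappa)) (b * (e / 2) / (L + 1)).
have d0 : 0 < d by rewrite lt_min divr_gt0// mulr_gt0.
have [K1 HK1] := ffull_tail d d0.
exists (maxn K0 K1) => // m /=; rewrite geq_max => /andP[K0m K1m].
rewrite sub0r normrN ger0_norm ?enorm_ge0// ltNge; apply/negP => gm.
(* While the gradient is at least [e / 2], the minimum in [full_decrease] must be the radius, as the
   other value would make [f_N] drop by at least [d]. *)
have step k : (m <= k)%N -> e / 2 <= gradN (acc k) ->
    b * s_Delta (s (acc k)) <= ffull phi (X k) - ffull phi (X k.+1).
  move=> mk gk.
  have dec := full_decrease k (leq_trans K0m mk).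
  have drop := HK1 k k.+1 (leq_trans K1m mk) (leqnSn k).
  have := le_lt_trans dec drop; rewrite lt_min => /andP[lt _].
  have le : b * Num.min (s_Delta (s (acc k))) (gradN (acc k) / kappa) <=
      ffull phi (X k) - ffull phi (X k.+1).
    apply: le_trans dec; rewrite /b -(mulrA c1) ler_wpM2l ?(ltW c1_gt0)//.
    by rewrite ler_wpM2r// min_radius_ge0.
  have [Dg|gD] := leP (s_Delta (s (acc k))) (gradN (acc k) / kappa).
    by move: le; rewrite (min_idPl Dg).
  exfalso; move: lt; rewrite (min_idPr (ltW gD)) ltNge => /negP; apply.
  rewrite /b -(mulrA c1) ler_wpM2l ?(ltW c1_gt0)//.
  apply: ler_pM => //; try exact: ltW.
  by rewrite ler_pM2r ?invr_gt0.
(* The gradient changes telescope, each being paid for by a decrease of [f_N]; starting from at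
   least [e], the gradient never falls below [e / 2]. *)
have stay i : gradN (acc m) - gradN (acc (m + i)) <=
    L / b * (ffull phi (X m) - ffull phi (X (m + i))) /\ e / 2 <= gradN (acc (m + i)).
  elim: i => [|i [IH gi]]; first by rewrite addn0 !subrr mulr0; split => //; lra.
  have mi : (m <= m + i)%N := leq_addr _ _.
  have D1 := step _ mi gi; have D2 := gradient_step (m + i).
  rewrite addnS.
  have D3 : L * s_Delta (s (acc (m + i))) <=
      L / b * (ffull phi (X (m + i)) - ffull phi (X (m + i).+1)).
    by rewrite -mulrA ler_wpM2l// mulrC ler_pdivlMr// mulrC.
  have inc : gradN (acc m) - gradN (acc (m + i).+1) <=
    L / b * (ffull phi (X m) - ffull phi (X (m + i).+1)) by lra.
  split => //.
  have := HK1 m (m + i).+1 K1m (leq_trans mi (leqnSn _)).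
  rewrite lt_min => /andP[_]; rewrite ltr_pdivlMr// => fd.
  have : L / b * (ffull phi (X m) - ffull phi (X (m + i).+1)) <= e / 2.
    have f0 : 0 <= ffull phi (X m) - ffull phi (X (m + i).+1) \/
      ffull phi (X m) - ffull phi (X (m + i).+1) < 0.
      by case: ltP; [right|left].
    case: f0 => f0; last first.
      by apply: le_trans (ltW e2); rewrite mulr_ge0_le0 ?divr_ge0 ?(ltW b0) ?(ltW f0).
    rewrite mulrAC ler_pdivrMr// mulrC; lra.
  lra.
have [k mk] := gradient_small (e / 2) m e2.
by rewrite -(subnKC mk) ltNge; have [_ ->] := stay (k - m)%N.
Qed.

End Full.
End Accepted.
End Run.

Theorem corollary2p6 (R : realType) (N n : nat) (hN : (1 <= N)%N) (hn : (1 <= n)%N)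
  (phi : 'I_N -> 'cV[R]_n -> R) (hphi : forall i, cont_differentiable (phi i))
  (h : nat -> R) (D : iretr_data R n) (hD : valid_data N D) (heps : d_epsg D = 0)
  (s : nat -> state R N n) (t : nat -> trial R N n) (hrun : infinite_run phi h D s t)
  (h_decr : forall i j : nat, (i < j)%N -> h j < h i)
  (h_1 : 0 < h 1%N) (h_N : h N = 0)
  (Omega : set 'cV[R]_n) (hOmega : compact Omega)
  (hx : forall j, Omega (s_x (s j)))
  (L : R)
  (hL : forall i j,
     lipschitz_grad_on L (segment (s_x (s j)) (s_x (s j) + t_p (t j))) (phi i))
  (kappaB : R) (hkappaB : 0 < kappaB) (hB : forall j, opnorm (t_B (t j)) <= kappaB) :
  exists acc : nat -> nat,
    [/\ forall k, ends_iteration phi h D s t k (acc k),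
        \forall k \near \oo,
          [/\ s_N (s (acc k)) = N, t_N (t (acc k)) = N
            & trust_region_step (ffull phi) (d_eta D) (d_tau D)
                (s_x (s (acc k))) (s_Delta (s (acc k)))
                (t_B (t (acc k))) (t_pC (t (acc k))) (t_p (t (acc k)))
                (s_x (s (acc k.+1)))],
        limn_einf (fun k => (enorm (grad (ffull phi) (s_x (s (acc k)))))%:E) = 0%E
      & lipschitz_fun_on Omega (ffull phi) ->
        (fun k => enorm (grad (ffull phi) (s_x (s (acc k))))) @ \oo --> (0 : R)].
Proof.
have dphi i x : differentiable (phi i) x by have [+ _] := hphi i; apply.
have [F F0 hF] := favg_bounded dphi Omega hOmega.
have {}hF I j : `|favg phi I (s_x (s j))| <= F by exact: hF.
(* The sign of [L] is not given; [|L|] is a nonnegative Lipschitz constant. *)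
have {}hL i j :
  lipschitz_grad_on `|L| (segment (s_x (s j)) (s_x (s j) + t_p (t j))) (phi i).
  move=> x y xs ys; apply: le_trans (hL i j x y xs ys) _.
  by rewrite ler_wpM2r ?enorm_ge0// ler_norm.
have L0 := normr_ge0 L.
have [acc acc_ends] := choice
  (ends_iteration_ex dphi hD heps hrun h_decr hN h_N L0 hL hkappaB hB hF).
have [K full] := eventually_full dphi hD heps hrun h_decr hN h_N L0 hL hkappaB hB
  F0 hF acc_ends.
exists acc; split => //.
- exists K => // k /= Kk; split; first exact: full.
  + exact: (trial_full dphi hD heps hrun h_decr hN h_N L0 hL hkappaB hB hF
      acc_ends full).
  + exact: (trust_region_step_full dphi hD heps hrun h_decr hN h_N L0 hL hkappaB hB
      hF acc_ends full).
- apply: limn_einf_eq0 => [k|e K1]; first exact: enorm_ge0.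
  exact: (gradient_small dphi hD heps hrun h_decr hN h_N L0 hL hkappaB hB hF
    acc_ends full).
- by move=> _; exact: (gradient_cvg dphi hD heps hrun h_decr hN h_N L0 hL hkappaB hB
    hF acc_ends full).
Qed.
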